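(* Let $T$ be a finite tree with $m\geqslant 1$ edges, and consider any random walk on $T$ defined by an edge-weight function, with asymmetry $\tau$. Then $\mathcal{H}(T)=\max_{x,y}\mathcal{H}(x,y)\leqslant\mathcal{F}(\tau,m)$, where $$\mathcal{F}(t,m)=m+\sum_{k=1}^{m-1}2(m-k)t^k.$$
   Context: An edge-weight function assigns a positive weight $w(x,y)=w(y,x)$ to each edge and defines the random walk with $p_{xy}=w(x,y)/\sum_z w(x,z)$. The asymmetry is $\tau=\max_x\max_{y,z\in\mathcal{N}(x)}w(x,y)/w(x,z)$, where $\mathcal{N}(x)$ is the set of neighbors of $x$. $\mathcal{H}(x,y)$ is the expected number of steps for the walk started at $x$ to first reach $y$. *)

(* Defs.v *)
From HB Require Import structures.
From mathcomp Require Import all_boot all_order all_algebra.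
From mathcomp Require Import all_classical all_reals all_analysis.

Set Implicit Arguments.
Unset Strict Implicit.
Unset Printing Implicit Defensive.

Import Order.TTheory GRing.Theory Num.Theory.

Local Open Scope ring_scope.

Definition simple_graph (V : finType) (e : rel V) : Prop :=
  symmetric e /\ irreflexive e.

Definition connected_graph (V : finType) (e : rel V) : Prop :=
  forall x y : V, connect e x y.

(* A duplicate-free closed walk of size at most 2 is not a graph cycle: an edge
   xy of a symmetric relation always gives the ucycle [:: x; y]. *)
Definition acyclic_graph (V : finType) (e : rel V) : Prop :=
  forall c : seq V, ucycle e c -> (size c <= 2)%N.

Definition tree (V : finType) (e : rel V) : Prop :=
  [/\ simple_graph e, connected_graph e & acyclic_graph e].

Definition edge_set (V : finType) (e : rel V) : {set {set V}} :=
  [set [set p.1; p.2] | p : V * V & e p.1 p.2].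

(* The values of w on pairs that are not edges are irrelevant. *)
Definition edge_weight (R : realType) (V : finType) (e : rel V)
    (w : V -> V -> R) : Prop :=
  forall x y : V, e x y -> 0 < w x y /\ w x y = w y x.

Definition transition (R : realType) (V : finType) (e : rel V)
    (w : V -> V -> R) (x y : V) : R :=
  if e x y then w x y / \sum_(z | e x z) w x z else 0.

(* All the ratios are positive, so the default value 0 of the maxima is
   harmless as soon as the graph has an edge. *)
Definition asymmetry (R : realType) (V : finType) (e : rel V)
    (w : V -> V -> R) : R :=
  \big[Num.max/0]_(x : V) \big[Num.max/0]_(y | e x y)
    \big[Num.max/0]_(z | e x z) (w x y / w x z).

(* Probability that the walk started at x has s as its sequence of next
   positions X_1, ..., X_(size s). *)
Fixpoint trajectory_prob (R : realType) (V : finType) (p : V -> V -> R)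
    (x : V) (s : seq V) : R :=
  if s is y :: s' then p x y * trajectory_prob p y s' else 1.

(* Probability that the walk started at X_0 = x first reaches y at time n.  For
   s = [:: X_1; ...; X_n], last x s is X_n and belast x s is
   [:: X_0; ...; X_(n-1)]; in particular the time is 0 when x = y. *)
Definition first_hit_prob (R : realType) (V : finType) (p : V -> V -> R)
    (x y : V) (n : nat) : R :=
  \sum_(s : n.-tuple V | (last x s == y) && (y \notin belast x s))
    trajectory_prob p x s.

Definition never_hit_prob (R : realType) (V : finType) (p : V -> V -> R)
    (x y : V) : \bar R :=
  (1 - \sum_(0 <= n <oo) (first_hit_prob p x y n)%:E)%E.

(* Expectation of the first hitting time, a random variable with values in the
   naturals extended with +oo.  In \bar R, +oo * 0 = 0. *)
Definition hitting_time (R : realType) (V : finType) (p : V -> V -> R)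
    (x y : V) : \bar R :=
  (\sum_(0 <= n <oo) (n%:R%:E * (first_hit_prob p x y n)%:E)
   + +oo * never_hit_prob p x y)%E.

Definition max_hitting_time (R : realType) (V : finType)
    (p : V -> V -> R) : \bar R :=
  \big[Order.max/-oo%E]_(x : V) \big[Order.max/-oo%E]_(y : V)
    hitting_time p x y.

Definition hitting_bound (R : realType) (t : R) (m : nat) : R :=
  m%:R + \sum_(1 <= k < m) 2 * (m - k)%:R * t ^+ k.

(* Main.v *)
Require Import Defs.
From HB Require Import structures.
From mathcomp Require Import all_boot all_order all_algebra.
From mathcomp Require Import all_classical all_reals all_analysis.
From mathcomp Require Import ring.

(** A nonnegative function phi with phi x >= 1 + sum_z p x z * phi z off the
    target y dominates the expected hitting time of y, so it is enough to
    exhibit such a phi that is bounded by F(t, m), t being the asymmetry.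
    Root the tree at y and let D x be the set of descendants of x, x included.
    With G n = 1 + t + ... + t^(n-1), the time needed to move from x to its
    parent is estimated by 2 G(#|D x|) - 1, and phi x is the sum of these
    estimates over the ancestors of x (x included, y excluded).  The inequality
    at x reduces to G(n + 1) = 1 + t G n, to the superadditivity of G (as
    t >= 1) and to the fact that the sets D z, for z a child of x, are disjoint
    in D x minus x.  Along a branch the numbers #|D a| are distinct and between
    1 and m, so phi x is at most the sum of 2 G k - 1 over 1 <= k <= m, which is
    F(t, m). *)

Set Implicit Arguments.
Unset Strict Implicit.
Unset Printing Implicit Defensive.

Import Order.TTheory GRing.Theory Num.Theory.

Local Open Scope ring_scope.

(** * Hitting times and superharmonic functions *)

Lemma first_hit_prob0 (R : realType) (V : finType) (p : V -> V -> R) x y :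
  first_hit_prob p x y 0 = (x == y)%:R.
Proof.
rewrite /first_hit_prob big_mkcond (big_pred1 [tuple]) => [|s]; last first.
  by rewrite [s]tuple0 /= eqxx.
by rewrite /= andbT; case: (x == y).
Qed.

(** First-step analysis: tuples are reindexed by head and tail. From [y] itself no positive time
    counts, since [y] then lies in [belast]. *)
Lemma first_hit_probS (R : realType) (V : finType) (p : V -> V -> R) x y n :
  first_hit_prob p x y n.+1 =
  if x == y then 0 else \sum_z p x z * first_hit_prob p z y n.
Proof.
rewrite /first_hit_prob.
pose f (u : V * n.-tuple V) := cons_tuple u.1 u.2.
rewrite (reindex f) /=; last first.
  exists (fun s => (thead s, behead_tuple s)) => [[z s]|s] _.
    by rewrite /f /thead tnth0 /=; congr pair; apply/val_inj.
  by rewrite /f /= [RHS]tuple_eta; apply/val_inj.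
case: eqVneq => [->|xy].
  by rewrite big_pred0 // => u; rewrite inE eqxx andbF.
under [RHS]eq_bigr do rewrite big_distrr /=.
rewrite pair_big_dep /=; apply: eq_bigl => u.
by rewrite inE [y == x]eq_sym (negPf xy).
Qed.

Lemma first_hit_prob_ge0 (R : realType) (V : finType) (p : V -> V -> R) x y n :
  (forall a b, 0 <= p a b) -> 0 <= first_hit_prob p x y n.
Proof.
move=> p_ge0; apply: sumr_ge0 => s _; elim: (val s) x => //= z s' IH x.
exact: mulr_ge0.
Qed.

Lemma sum_first_hit_prob_le1 (R : realType) (V : finType) (p : V -> V -> R)
    x y N :
  (forall a b, 0 <= p a b) -> (forall a, a != y -> \sum_b p a b = 1) ->
  \sum_(0 <= n < N) first_hit_prob p x y n <= 1.
Proof.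
move=> p_ge0 p_sum; elim: N x => [|N IH] x; first by rewrite big_geq.
rewrite big_nat_recl // first_hit_prob0.
under eq_bigr do rewrite first_hit_probS.
case: eqVneq => [_|xy]; first by rewrite big1_eq addr0.
rewrite add0r exchange_big /= -(p_sum _ xy); apply: ler_sum => z _.
by rewrite -mulr_sumr ler_piMr.
Qed.

(* The left-hand side is the expectation of min(T, N), T being the hitting
   time of y. *)
Lemma truncated_hitting_time_le (R : realType) (V : finType) (p : V -> V -> R)
    (phi : V -> R) x y N :
  (forall a b, 0 <= p a b) -> (forall a, a != y -> \sum_b p a b = 1) ->
  (forall a, 0 <= phi a) ->
  (forall a, a != y -> 1 + \sum_b p a b * phi b <= phi a) ->
  \sum_(0 <= n < N) n%:R * first_hit_prob p x y n
    + N%:R * (1 - \sum_(0 <= n < N) first_hit_prob p x y n) <= phi x.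
Proof.
move=> p_ge0 p_sum phi_ge0 phi_super; elim: N x => [|N IH] x.
  by rewrite !big_geq // mul0r addr0.
rewrite !big_nat_recl // first_hit_prob0 mul0r add0r.
under eq_bigr do rewrite first_hit_probS.
under [X in 1 - (_ + X)]eq_bigr do rewrite first_hit_probS.
case: eqVneq => [_|xy].
  by rewrite big1_eq addr0 subrr mulr0 big1 ?addr0 // => n _; rewrite mulr0.
apply: le_trans (phi_super _ xy).
rewrite add0r; under eq_bigr do rewrite mulr_sumr.
rewrite exchange_big /= [X in 1 - X]exchange_big /=.
(* Both constants 1 become [\sum_z p x z], so that the inequality can be proved term by term in
   [z]. *)
rewrite -[X in X - _](p_sum _ xy) -[X in _ <= X + _](p_sum _ xy).
rewrite -sumrB mulr_sumr -!big_split /=.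
apply: ler_sum => z _.
set q := first_hit_prob p z y.
rewrite -mulr_sumr (eq_bigr (fun n => p x z * (n%:R * q n + q n))); last first.
  by move=> n _; rewrite mulrCA -natr1 mulrDl mul1r.
rewrite -mulr_sumr big_split /=.
set A := \sum_(_ <= _ < _) _; set B := \sum_(_ <= _ < _) _.
have -> : p x z * (A + B) + N.+1%:R * (p x z - p x z * B) =
          p x z + p x z * (A + N%:R * (1 - B)) by rewrite -natr1; ring.
by rewrite lerD2l; apply: ler_wpM2l; [exact: p_ge0 | exact: IH].
Qed.

(** The truncated bound contains [N] times the probability of not having hit [y] before time [N].
    Since it is bounded in [N], the target is hit almost surely, and only the partial expectations
    remain to be bounded. *)
Lemma hitting_time_le (R : realType) (V : finType) (p : V -> V -> R)
    (phi : V -> R) x y :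
  (forall a b, 0 <= p a b) -> (forall a, a != y -> \sum_b p a b = 1) ->
  (forall a, 0 <= phi a) ->
  (forall a, a != y -> 1 + \sum_b p a b * phi b <= phi a) ->
  (hitting_time p x y <= (phi x)%:E)%E.
Proof.
move=> p_ge0 p_sum phi_ge0 phi_super.
have trunc N :=
  @truncated_hitting_time_le _ _ _ _ x _ N p_ge0 p_sum phi_ge0 phi_super.
have le1 N := @sum_first_hit_prob_le1 _ _ _ x _ N p_ge0 p_sum.
have q_ge0 n := @first_hit_prob_ge0 _ _ _ x y n p_ge0.
move: trunc le1 q_ge0; rewrite /hitting_time /never_hit_prob.
move: (first_hit_prob p x y) => q trunc le1 q_ge0.
set S := (\sum_(0 <= n <oo) (q n)%:E)%E.
have S_le1 : (S <= 1)%E.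
  apply: lime_le; first by apply: is_cvg_nneseries => n _ _; rewrite lee_fin.
  by apply: nearW => N; rewrite sumEFin lee_fin.
have S_ge N : ((\sum_(0 <= n < N) q n)%:E <= S)%E.
  by rewrite -sumEFin; apply: nneseries_lim_ge => n _ _; rewrite lee_fin.
have -> : S = 1%E.
  have S_ge0 : (0 <= S)%E by have := S_ge 0%N; rewrite big_geq.
  move: S S_le1 S_ge S_ge0 => [s| |] //; rewrite !lee_fin => s_le1 s_ge _.
  congr EFin; apply/eqP; rewrite eq_le s_le1 /= leNgt; apply/negP => s_lt1.
  have c_gt0 : 0 < 1 - s by rewrite subr_gt0.
  (* An [N] with [N * (1 - s) > phi x] contradicts [trunc N]. *)
  have /archi_boundP := divr_ge0 (phi_ge0 x) (ltW c_gt0).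
  set N := Num.bound _; rewrite ltr_pdivrMr // ltNge => /negP; apply.
  apply: le_trans (trunc N).
  rewrite -[leLHS]add0r lerD //.
    by apply: sumr_ge0 => n _; rewrite mulr_ge0.
  by rewrite ler_wpM2l // lerB // -lee_fin.
rewrite subee // mule0 adde0.
apply: lime_le.
  by apply: is_cvg_nneseries => n _ _; rewrite -EFinM lee_fin mulr_ge0.
apply: nearW => N; under eq_bigr do rewrite -EFinM.
rewrite sumEFin lee_fin; apply: le_trans (trunc N).
by rewrite lerDl mulr_ge0 // subr_ge0.
Qed.

(** * Rooted trees *)

(* The root is its own parent, so that the ancestors of x are exactly the
   vertices a with [fconnect pi x a]; d only makes pi well-founded. *)
Definition rooting (V : finType) (e : rel V) (y : V) (pi : V -> V)
    (d : V -> nat) : Prop :=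
  pi y = y /\ forall x, x != y -> e x (pi x) /\ (d (pi x) < d x)%N.


(** Take for [d x] the length of a shortest walk from [x] to [y], and for [pi x] the second vertex
    of such a walk. *)
Lemma connected_rooting (V : finType) (e : rel V) (y : V) :
  connected_graph e -> exists pi d, rooting e y pi d.
Proof.
move=> conn.
pose P x := [pred n | [exists s : n.-tuple V, path e x s && (last x s == y)]].
have exP x : exists n, P x n.
  have /connectP[s ps ls] := conn x y.
  by exists (size s); apply/existsP; exists (in_tuple s); rewrite /= ps -ls /=.
pose d x := ex_minn (exP x).
have step x : exists z, if x == y then z = y else e x z /\ (d z < d x)%N.
  case: eqVneq => [_|xy]; first by exists y.
  rewrite {2}/d; case: ex_minnP => n /existsP[[[|z s] /=]].
    by move=> _ /eqP xy'; rewrite xy' eqxx in xy.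
  move=> sn /andP[/andP[xz ps] ls] _; exists z; split=> //.
  rewrite /d; case: ex_minnP => k _ kmin.
  move/eqP: sn => <-; rewrite ltnS; apply: kmin.
  by apply/existsP; exists (in_tuple s); rewrite /= ps.
have [pi piP] := choice step.
exists pi, d; split=> [|x xy]; first by have := piP y; rewrite eqxx.
by have := piP x; rewrite (negPf xy).
Qed.

(** A path avoiding the edge could be shortened to a simple one and closed by [xz] into a cycle. *)
Lemma acyclic_edge_bridge (V : finType) (e : rel V) (x z : V) :
  tree e -> e x z ->
  ~~ connect [rel a b | e a b && ([set a; b] != [set x; z])] x z.
Proof.
case=> [[esym eirr] _ acyc] exz; apply/negP => /connectP[p0 pp0].
case: (shortenP pp0) => p pp up _ lp.
have pe : path e x p by apply: sub_path pp => a b /= /andP[].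
have : ucycle e (x :: p).
  by rewrite /ucycle up andbT /= rcons_path pe -lp esym.
(* Size at most 2 leaves the empty path, which makes [xz] a loop, and the single step along the
   deleted edge. *)
move/acyc; case: p pp lp {up pe} => [|a [|b p]] //=.
- by move=> _ zx; rewrite zx eirr in exz.
- by move=> /andP[/andP[_ /negP nxa] _] za; rewrite za eqxx in nxa.
Qed.

(** The relation [r] is kept general in order to take [e] with one edge deleted. *)
Lemma rooting_connect_root (V : finType) (e r : rel V) (y : V) pi d :
  rooting e y pi d -> (forall x, x != y -> r x (pi x)) ->
  forall x, connect r x y.
Proof.
case=> _ dP rpi x; have [n] := ubnP (d x); elim: n x => // n IH x dx.
have [->|xy] := eqVneq x y; first exact: connect0.
have [_ lt_d] := dP x xy.
apply: connect_trans (connect1 (rpi x xy)) (IH _ _).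
exact: leq_trans lt_d dx.
Qed.

(* Otherwise the parent edges join x and z to the root without using xz. *)
Lemma rooting_edge (V : finType) (e : rel V) (y : V) pi d x z :
  tree e -> rooting e y pi d -> e x z -> pi x = z \/ pi z = x.
Proof.
move=> te rt exz; have [//|pix] := pselect (pi x = z); first by left.
have [piz|piz] := pselect (pi z = x); first by right.
have := acyclic_edge_bridge te exz; set r := (X in connect X) => /negP[].
have [[e_sym _] _ _] := te.
have rsym : symmetric r.
  by move=> a b; rewrite /r /= e_sym [[set a; b]]finset.setUC.
have rpi a : a != y -> r a (pi a).
  move=> ay; case: (rt) => _ /(_ a ay)[eap _]; rewrite /r /= eap /=.
  apply/eqP => /setP s.
  have := s a; rewrite !inE eqxx /= => /esym /orP[] /eqP ea; subst a.
    have := s z; rewrite !inE eqxx orbT => /orP[] /eqP ea; last by apply: pix.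
    by move: exz; case: te => [[_ eirr] _ _]; rewrite ea eirr.
  have := s x; rewrite !inE eqxx => /orP[] /eqP ea; last by apply: piz.
  by move: exz; case: te => [[_ eirr] _ _]; rewrite ea eirr.
have cr := rooting_connect_root rt rpi.
by apply: connect_trans (cr x) _; rewrite (sym_connect_sym rsym).
Qed.

(** Non-root vertices inject into the edges by [[set x; pi x]]: two distinct ones sharing an edge
    would be each other's parent, against the decrease of [d]. *)
Lemma card_rooting (V : finType) (e : rel V) (y : V) pi d :
  rooting e y pi d -> (#|V| <= #|edge_set e|.+1)%N.
Proof.
case=> _ dP; rewrite -cardsT (cardsD1 y) inE add1n ltnS.
rewrite -(@card_in_imset _ _ (fun x => [set x; pi x])); last first.
  move=> a b; rewrite !inE !andbT => /dP[_ da] /dP[_ db] /setP s.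
  have := s a; rewrite !inE eqxx /= => /esym /orP[/eqP //|/eqP ea].
  have := s b; rewrite !inE eqxx /= => /orP[/eqP //|/eqP eb].
  by rewrite -eb -ea in da db; rewrite ltnNge ltnW in da.
apply/subset_leq_card/fintype.subsetP => u /imsetP[x].
rewrite !inE andbT => /dP[ex _].
by move=> ->; apply/imsetP; exists (x, pi x); rewrite ?inE.
Qed.

Lemma fconnect_linear (V : finType) (f : V -> V) u a b :
  fconnect f u a -> fconnect f u b -> fconnect f a b || fconnect f b a.
Proof.
move=> /iter_findex <- /iter_findex <-.
move: (findex f u a) (findex f u b) => i j.
by case: (leqP i j) => [|/ltnW] /subnK <-; rewrite iterD fconnect_iter ?orbT.
Qed.

Lemma rooting_depth (V : finType) (e : rel V) (y : V) pi d u a :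
  rooting e y pi d -> fconnect pi u a -> u != a -> (d a < d u)%N.
Proof.
case=> piy dP /iter_findex <-; elim: (findex pi u a) => [|n IH] /=.
  by rewrite eqxx.
set b := iter n pi u in IH *.
have [by_|/dP[_ db] _] := eqVneq b y; first by rewrite by_ piy -by_.
by have [ub|/IH] := eqVneq u b; [rewrite ub | apply: ltn_trans].
Qed.

(** * Sizes of descendant sets *)

Definition descendants (V : finType) (pi : V -> V) (a : V) : {set V} :=
  [set u | fconnect pi u a].

Lemma card_descendants_gt0 (V : finType) (pi : V -> V) a :
  (0 < #|descendants pi a|)%N.
Proof. by apply/card_gt0P; exists a; rewrite inE connect0. Qed.

Lemma card_descendants_lt (V : finType) (e : rel V) (y : V) pi d a :
  rooting e y pi d -> a != y -> (#|descendants pi a| < #|V|)%N.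
Proof.
move=> [piy _] ay; rewrite -cardsT; apply/proper_card/properP.
split; first exact: finset.subsetT.
exists y; rewrite // inE; apply/negP => /iter_findex.
by rewrite iter_fix // => ya; rewrite ya eqxx in ay.
Qed.

(** Ancestors of [u] are comparable, and of two distinct ones the higher has strictly more
    descendants. *)
Lemma card_descendants_inj (V : finType) (e : rel V) (y : V) pi d u a b :
  rooting e y pi d -> fconnect pi u a -> fconnect pi u b ->
  #|descendants pi a| = #|descendants pi b| -> a = b.
Proof.
move=> rt.
wlog ab : a b / fconnect pi a b => [H|_ _ Dab].
  move=> ua ub; have /orP[ab|ba] := fconnect_linear ua ub; first exact: H.
  by move=> ?; apply/esym/H.
apply/eqP/negPn/negP => nab; have dab := rooting_depth rt ab nab.
suff /proper_card : descendants pi a \proper descendants pi b.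
  by rewrite Dab ltnn.
apply/properP; split.
  by apply/fintype.subsetP => v; rewrite !inE => va; apply: connect_trans ab.
exists b; rewrite inE ?connect0 //; apply/negP => ba.
have := rooting_depth rt ba; rewrite eq_sym nab ltnNge (ltnW dab).
by move/(_ isT).
Qed.

Lemma card_descendants_children (V : finType) (e : rel V) (y : V) pi d x :
  rooting e y pi d -> x != y ->
  (\sum_(z | pi z == x) #|descendants pi z| < #|descendants pi x|)%N.
Proof.
move=> rt xy; case: (rt) => piy dP.
have dlt z : pi z == x -> (d x < d z)%N.
  move=> /eqP zx; rewrite -zx; apply: (proj2 (dP _ _)).
  by apply: contraNneq xy => zy; rewrite -zx zy piy.
rewrite [X in (_ < X)%N](cardsD1 x) inE connect0 add1n ltnS.
(* Double counting: after the exchange of sums, each [u] must descend from at most one child of [x],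
   and from none if [u = x]. *)
rewrite (eq_bigr (fun z => \sum_u (fconnect pi u z : nat))%N); last first.
  move=> z _; rewrite -sum1_card big_mkcond; apply: eq_bigr => u _.
  by rewrite inE; case: ifP.
rewrite exchange_big /= -sum1_card [X in (_ <= X)%N]big_mkcond /=.
apply: leq_sum => u _.
have [[z /andP[zx uz]]|none] :=
  pselect (exists z, (pi z == x) && fconnect pi u z).
  rewrite (bigD1 z) //= big1 => [|v /andP[vx vz]].
    rewrite uz addn0 !inE (connect_trans uz) ?andbT -?(eqP zx) ?fconnect1 //.
    case: eqVneq => // ux; move: (dlt _ zx); rewrite -(eqP zx) -ux.
    have [<-|nuz] := eqVneq u z; first by rewrite ltnn.
    by rewrite ltnNge (ltnW (rooting_depth rt uz nuz)).
  apply/eqP; rewrite eqb0; apply/negP => uv.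
  (* Comparable children coincide: a strict ancestor of a child is an ancestor of [x], where [d] is
     at most [d x]. *)
  have key s t : pi s == x -> pi t == x -> fconnect pi s t -> s = t.
    move=> sx tx; rewrite fconnect_eqVf => /orP[/eqP //|].
    rewrite (eqP sx) => xt.
    have := dlt _ tx; have [<-|nxt] := eqVneq x t; first by rewrite ltnn.
    by rewrite ltnNge (ltnW (rooting_depth rt xt nxt)).
  case/orP: (fconnect_linear uv uz) => [/(key _ _ vx zx) E|/(key _ _ zx vx) E].
    by move: vz; rewrite E eqxx.
  by move: vz; rewrite E eqxx.
rewrite big1 // => z zx; apply/eqP; rewrite eqb0; apply/negP => uz.
by apply: none; exists z; rewrite zx.
Qed.

(** * The potential *)

Definition geom (R : pzSemiRingType) (t : R) (n : nat) : R :=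
  \sum_(0 <= k < n) t ^+ k.

Lemma geomS (R : comPzRingType) (t : R) n : geom t n.+1 = 1 + t * geom t n.
Proof.
rewrite /geom big_nat_recl // expr0 mulr_sumr; congr (_ + _).
by apply: eq_bigr => k _; rewrite exprS.
Qed.

Lemma geom_ge0 (R : numDomainType) (t : R) n : 0 <= t -> 0 <= geom t n.
Proof. by move=> t_ge0; apply: sumr_ge0 => k _; rewrite exprn_ge0. Qed.

(** The last [b] exponents are those of [geom t b] shifted up by [a], which cannot decrease powers
    of [t >= 1]. *)
Lemma geomD_ge (R : numDomainType) (t : R) a b :
  1 <= t -> geom t a + geom t b <= geom t (a + b).
Proof.
move=> t_ge1; rewrite /geom (@big_cat_nat _ _ _ a 0 (a + b)) //= ?leq_addr //.
rewrite lerD2l -{1}[a]add0n big_addn addKn.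
by apply: ler_sum => k _; rewrite ler_weXn2l // leq_addr.
Qed.

Lemma geom_mono (R : numDomainType) (t : R) a b :
  1 <= t -> (a <= b)%N -> geom t a <= geom t b.
Proof.
move=> t_ge1 /subnKC <-; apply: le_trans (geomD_ge _ _ t_ge1).
by rewrite lerDl geom_ge0 // (le_trans ler01).
Qed.

Lemma sum_geom_le (R : numDomainType) (I : finType) (P : pred I) (t : R)
    (c : I -> nat) :
  1 <= t -> \sum_(i | P i) geom t (c i) <= geom t (\sum_(i | P i) c i).
Proof.
move=> t_ge1; elim/big_rec2: _ => [|i n s _ IH].
  by rewrite geom_ge0 // (le_trans ler01).
by apply: le_trans (geomD_ge _ _ t_ge1); rewrite lerD2l.
Qed.

(** Passing from [m] to [m + 1] adds 1 and raises each coefficient by 2, an increment of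
    [1 + 2 * (t + ... + t ^+ m)]. *)
Lemma hitting_boundE (R : realType) (t : R) m :
  hitting_bound t m = \sum_(0 <= i < m) (2 * geom t i.+1 - 1).
Proof.
elim: m => [|m IH]; first by rewrite /hitting_bound !big_geq // addr0.
rewrite big_nat_recr //= -IH /hitting_bound.
(* The extra term [k = m] has coefficient [m - m = 0]. *)
have -> : \sum_(1 <= k < m) 2 * (m - k)%:R * t ^+ k
        = \sum_(1 <= k < m.+1) 2 * (m - k)%:R * t ^+ k.
  case: m {IH} => [|m]; first by rewrite !big_geq.
  by rewrite [RHS]big_nat_recr //= subnn mulr0 mul0r addr0.
have -> : \sum_(1 <= k < m.+1) 2 * (m.+1 - k)%:R * t ^+ k =
    \sum_(1 <= k < m.+1) 2 * (m - k)%:R * t ^+ k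
    + 2 * \sum_(1 <= k < m.+1) t ^+ k.
  rewrite mulr_sumr -big_split /=; apply: eq_big_nat => k /andP[_ km].
  by rewrite subSn // -natr1; ring.
have -> : geom t m.+1 = 1 + \sum_(1 <= k < m.+1) t ^+ k.
  by rewrite /geom big_ltn // expr0.
by rewrite -natr1; ring.
Qed.

Lemma sum_inj_le (R : numDomainType) (I : finType) (P : pred I) (c : I -> nat)
    (f : nat -> R) m :
  (forall n, 0 <= f n) -> {in P &, injective c} ->
  (forall i, P i -> c i < m)%N ->
  \sum_(i | P i) f (c i) <= \sum_(0 <= n < m) f n.
Proof.
move=> f_ge0 c_inj c_lt.
pose s := [seq c i | i <- enum P].
have -> : \sum_(i | P i) f (c i) = \sum_(n <- s) f n.
  by rewrite big_map big_enum.
rewrite (perm_big [seq n <- index_iota 0 m | n \in s]) /=.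
  rewrite big_filter big_mkcond; apply: ler_sum => n _.
  by case: ifP.
apply: uniq_perm.
- rewrite map_inj_in_uniq ?enum_uniq // => i j.
  by rewrite !mem_enum; apply: c_inj.
- by rewrite filter_uniq // iota_uniq.
move=> n; rewrite mem_filter mem_index_iota /=.
case: (boolP (n \in s)) => //= /mapP[i].
by rewrite mem_enum => /c_lt ? ->.
Qed.

Lemma asymmetry_ge (R : realType) (V : finType) (e : rel V) (w : V -> V -> R)
    x y z : e x y -> e x z -> w x y / w x z <= asymmetry e w.
Proof.
move=> exy exz; rewrite /asymmetry.
apply: le_trans (le_bigmax _ _ x).
apply: le_trans (le_bigmax_cond _ _ exy).
exact: (le_bigmax_cond _ (fun z => w x y / w x z) exz).
Qed.

Definition step_bound (R : pzRingType) (V : finType) (t : R) (pi : V -> V)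
    (a : V) : R := 2 * geom t #|descendants pi a| - 1.

Definition potential (R : pzRingType) (V : finType) (t : R) (pi : V -> V)
    (y x : V) : R :=
  \sum_(a | fconnect pi x a && (a != y)) step_bound t pi a.

Lemma geom_step_bound_ge0 (R : numDomainType) (t : R) n :
  0 <= t -> 0 <= 2 * geom t n.+1 - 1.
Proof.
move=> t_ge0.
have -> : 2 * geom t n.+1 - 1 = 1 + 2 * (t * geom t n) by rewrite geomS; ring.
by rewrite addr_ge0 ?mulr_ge0 ?geom_ge0.
Qed.

Lemma potential_parent (R : pzRingType) (V : finType) (e : rel V) (t : R) y
    pi d z :
  rooting e y pi d -> z != y ->
  potential t pi y z = step_bound t pi z + potential t pi y (pi z).
Proof.
move=> rt zy; rewrite /potential (bigD1 z) ?connect0 //=; congr (_ + _).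
apply: eq_bigl => a; rewrite [fconnect pi z a]fconnect_eqVf [z == a]eq_sym.
case: eqVneq => [->|] /=; last by rewrite andbT.
(* The vertex [z] is not an ancestor of its own parent, since [d] decreases upwards. *)
rewrite andbF; apply/esym/negP => /andP[pzz _].
have [_ /(_ z zy)[_ dlt]] := rt.
have [pz|npz] := eqVneq (pi z) z; first by rewrite pz ltnn in dlt.
by have := rooting_depth rt pzz npz; rewrite ltnNge (ltnW dlt).
Qed.

Lemma potential_le (R : realType) (V : finType) (e : rel V) (t : R) y pi d x :
  0 <= t -> rooting e y pi d ->
  potential t pi y x <= hitting_bound t #|edge_set e|.
Proof.
move=> t_ge0 rt; rewrite hitting_boundE /potential.
(* The shift turns sizes from 1 to the number of edges into the indices of [hitting_boundE], which
   start at 0. *)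
pose c a := #|descendants pi a|.-1.
have cS a : #|descendants pi a| = (c a).+1.
  by rewrite prednK // card_descendants_gt0.
under eq_bigr do rewrite /step_bound cS.
apply: (@sum_inj_le _ _ _ c (fun n => 2 * geom t n.+1 - 1)).
- by move=> n; apply: geom_step_bound_ge0.
- move=> a b /andP[xa _] /andP[xb _] cab.
  by apply: (card_descendants_inj rt xa xb); rewrite !cS cab.
- move=> a /andP[_ ay]; rewrite -ltnS -cS.
  exact: leq_trans (card_descendants_lt rt ay) (card_rooting rt).
Qed.

Lemma potential_superharmonic (R : realType) (V : finType) (e : rel V)
    (w : V -> V -> R) y pi d x :
  tree e -> edge_weight e w -> rooting e y pi d -> x != y ->
  1 + \sum_z transition e w x z * potential (asymmetry e w) pi y z
    <= potential (asymmetry e w) pi y x.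
Proof.
move=> te ew rt xy; set t := asymmetry e w; set phi := potential t pi y.
have [piy /(_ x xy)[exp _]] := rt.
have wp_gt0 : 0 < w x (pi x) by have [] := ew _ _ exp.
(* The ratio of [w x (pi x)] to itself is among those maximized. *)
have t_ge1 : 1 <= t.
  by apply: le_trans (asymmetry_ge w exp exp); rewrite divff // gt_eqF.
have w_le z : e x z -> w x z <= t * w x (pi x).
  by move=> exz; rewrite -ler_pdivrMr //; apply: asymmetry_ge.
set W := \sum_(z | e x z) w x z.
have W_gt0 : 0 < W.
  rewrite /W (bigD1 (pi x)) //= ltr_wpDr // sumr_ge0 // => z /andP[exz _].
  by have [/ltW] := ew _ _ exz.
have -> : \sum_z transition e w x z * phi z
        = (\sum_(z | e x z) w x z * phi z) / W.
  rewrite mulr_suml [RHS]big_mkcond /=; apply: eq_bigr => z _.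
  by rewrite /transition -/W; case: ifP; rewrite ?mul0r // mulrAC.
(* Clear the denominator [W], then split the parent's term off both sums. *)
rewrite -(ler_pM2r W_gt0) mulrDl mul1r divfK ?gt_eqF //.
rewrite /W mulr_sumr -big_split /= (bigD1 (pi x)) //= [leRHS](bigD1 (pi x)) //=.
have child z : e x z && (z != pi x) -> pi z == x.
  case/andP=> exz zx; have [zp|->//] := rooting_edge te rt exz.
  by rewrite zp eqxx in zx.
have child_root z : pi z == x -> z != y.
  by move=> /eqP zx; apply: contraNneq xy => zy; rewrite -zx zy piy.
have phi_x := potential_parent t rt xy; rewrite -!/phi in phi_x.
have phi_z z : e x z && (z != pi x) -> phi z = step_bound t pi z + phi x.
  move=> /child zx; have := potential_parent t rt (child_root _ zx).
  by rewrite (eqP zx).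
set G := geom t #|descendants pi x|.-1.
have hx : step_bound t pi x = 1 + 2 * t * G.
  rewrite /step_bound -(prednK (card_descendants_gt0 pi x)) geomS -/G; ring.
have sumG : \sum_(z | e x z && (z != pi x)) geom t #|descendants pi z| <= G.
  apply: le_trans (sum_geom_le _ _ t_ge1) _; apply: geom_mono => //.
  rewrite -ltnS prednK ?card_descendants_gt0 //.
  apply: leq_ltn_trans (card_descendants_children rt xy).
  rewrite [X in (_ <= X)%N](bigID (fun z => e x z && (z != pi x))) /=.
  apply: leq_trans (leq_addr _ _).
  rewrite (eq_bigl (fun z => (pi z == x) && (e x z && (z != pi x)))) // => z.
  by case: (boolP (e x z && _)) => [/child ->|]; rewrite ?andbF.
have sumw : \sum_(z | e x z && (z != pi x)) w x z * geom t #|descendants pi z|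
            <= t * w x (pi x) * G.
  apply: (@le_trans _ _ (\sum_(z | e x z && (z != pi x))
      t * w x (pi x) * geom t #|descendants pi z|)).
    apply: ler_sum => z /andP[exz _]; rewrite ler_wpM2r ?w_le //.
    by rewrite geom_ge0 // (le_trans ler01).
  by rewrite -mulr_sumr ler_wpM2l // mulr_ge0 ?ltW // (lt_le_trans ltr01).
(* The 1 cancels the -1 of [step_bound], leaving twice the sum bounded in [sumw]; the terms in
   [phi x] also occur on the right-hand side. *)
have -> : \sum_(z | e x z && (z != pi x)) (w x z + w x z * phi z)
  = 2 * (\sum_(z | e x z && (z != pi x)) w x z * geom t #|descendants pi z|)
    + \sum_(z | e x z && (z != pi x)) phi x * w x z.
  rewrite mulr_sumr -big_split /=; apply: eq_bigr => z /phi_z ->.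
  by rewrite /step_bound; ring.
rewrite addrA lerD2r phi_x hx.
have -> : (1 + 2 * t * G + phi (pi x)) * w x (pi x)
  = w x (pi x) + w x (pi x) * phi (pi x) + 2 * (t * w x (pi x) * G) by ring.
by rewrite lerD2l ler_pM2l.
Qed.

(** * Stochasticity of the walk and conclusion *)

Lemma transition_ge0 (R : realType) (V : finType) (e : rel V)
    (w : V -> V -> R) x y : edge_weight e w -> 0 <= transition e w x y.
Proof.
move=> ew; rewrite /transition; case: ifP => // exy.
have w_ge0 z : e x z -> 0 <= w x z by move=> /ew[/ltW].
by rewrite divr_ge0 ?w_ge0 // sumr_ge0.
Qed.

Lemma transition_sum1 (R : realType) (V : finType) (e : rel V)
    (w : V -> V -> R) x y :
  edge_weight e w -> e x y -> \sum_z transition e w x z = 1.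
Proof.
move=> ew exy; rewrite -big_mkcond /= -mulr_suml divff // gt_eqF //.
rewrite (bigD1 y) //= ltr_wpDr ?(ew _ _ exy).1 // sumr_ge0 // => z /andP[exz _].
by have [/ltW] := ew _ _ exz.
Qed.

Theorem theorem8 (R : realType) (V : finType) (e : rel V) (m : nat)
    (w : V -> V -> R) (tree_e : tree e) (card_e : #|edge_set e| = m)
    (m_gt0 : (1 <= m)%N) (w_weight : edge_weight e w) :
  (max_hitting_time (transition e w) <= (hitting_bound (asymmetry e w) m)%:E)%E.
Proof.
apply: bigmax_le => [|x _]; first exact: leNye.
apply: bigmax_le => [|y _]; first exact: leNye.
have [_ conn _] := tree_e; have [pi [d rt]] := connected_rooting y conn.
(* Nonnegativity comes from the default value 0 of the maximum. *)
have t_ge0 : 0 <= asymmetry e w by apply: bigmax_ge_id.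
apply: (@le_trans _ _ (potential (asymmetry e w) pi y x)%:E); last first.
  by rewrite lee_fin -card_e; apply: potential_le rt.
apply: hitting_time_le => [a b|a ay|a|a ay].
- exact: transition_ge0.
- by have [_ /(_ a ay)[eap _]] := rt; apply: transition_sum1 eap.
- apply: sumr_ge0 => b _; rewrite /step_bound.
  by rewrite -(prednK (card_descendants_gt0 pi b)) geom_step_bound_ge0.
- exact: potential_superharmonic rt ay.
Qed.
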